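(* Let $l\ge 1$ be an integer, $a>0$, $k_0>0$, and let $\epsilon_{\mathrm b}\in\mathbb{C}\setminus(-\infty,0]$ with $\operatorname{Im}\epsilon_{\mathrm b}\ge 0$, $k_{\mathrm b}=k_0\sqrt{\epsilon_{\mathrm b}}$. Let $a_{2l}$, $b_{2l}$, $c_{2l}$ and the electric multipole absorption cross section $$C_{\mathrm{abs},2l}(t)=\frac{2\pi(2l+1)}{|k_{\mathrm b}|^2}\left(a_{2l}|t|^2+2\operatorname{Re}\{b_{2l}t\}+c_{2l}\right),\qquad t\in\mathbb{C},$$ be as defined in the context. Then $a_{2l}<0$, so that $C_{\mathrm{abs},2l}$ is a strictly concave quadratic form in $t\in\mathbb{C}$ with a unique maximizer. The maximizer is $$t=-\frac{b_{2l}^*}{a_{2l}},$$ and the maximal value (the optimal absorption cross section of the rotationally invariant sphere) is $$C_{\mathrm{abs},2l}^{\mathrm{opt}}=\frac{\pi(2l+1)}{2|k_{\mathrm b}|^2}\left(-\frac{4|b_{2l}|^2}{a_{2l}}+4c_{2l}\right).$$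
   Context: Square roots are principal (branch cut along the negative real axis); $z^*$ is the complex conjugate. $\mathrm{j}_l$ is the spherical Bessel function and $\mathrm{h}_l^{(1)}$ the spherical Hankel function of the first kind; the Riccati-Bessel functions are $\psi_l(z)=z\,\mathrm{j}_l(z)$, $\xi_l(z)=z\,\mathrm{h}^{(1)}_l(z)$, and a prime denotes the derivative with respect to the argument. Define $$a_{2l}=-\operatorname{Im}\left\{\frac{k_{\mathrm b}^*}{\operatorname{Re} k_{\mathrm b}}\,\xi_l'(k_{\mathrm b}a)\,\xi_l(k_{\mathrm b}a)^*\right\},$$ $$b_{2l}=\frac{1}{2\mathrm i}\left(-\frac{k_{\mathrm b}^*}{\operatorname{Re} k_{\mathrm b}}\,\xi_l'(k_{\mathrm b}a)\,\psi_l(k_{\mathrm b}a)^*+\frac{k_{\mathrm b}}{\operatorname{Re} k_{\mathrm b}}\,\psi_l'(k_{\mathrm b}a)^*\,\xi_l(k_{\mathrm b}a)\right),$$ $$c_{2l}=-\operatorname{Im}\left\{\frac{k_{\mathrm b}^*}{\operatorname{Re} k_{\mathrm b}}\,\psi_l'(k_{\mathrm b}a)\,\psi_l(k_{\mathrm b}a)^*\right\}.$$ Physical meaning: a rotationally invariant sphere of radius $a$ in a passive background of relative permittivity $\epsilon_{\mathrm b}$ (time convention $\mathrm e^{-\mathrm i\omega t}$, vacuum wavenumber $k_0$) scatters the electric multipole of order $l$ with a complex scattering coefficient $t=t_{2l}$ independent of the azimuthal index. With plane wave incidence, $C_{\mathrm{abs},2l}(t)$ is the power absorbed by the sphere in that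 multipole divided by the plane wave intensity at the origin. *)

(* Defs.v *)
From Stdlib Require Import Reals.
From Coquelicot Require Import Coquelicot.
Open Scope R_scope.

(* Principal square root in Cartesian form: the root with nonnegative real
   part, and with nonnegative imaginary part on the cut (-oo, 0]. *)
Definition Csqrt (z : C) : C :=
  (sqrt ((Cmod z + Re z) / 2),
   (if Rle_dec 0 (Im z) then 1 else -1) * sqrt ((Cmod z - Re z) / 2)).

Definition Cexp (z : C) : C :=
  (exp (Re z) * cos (Im z), exp (Re z) * sin (Im z)).

Definition Csin (z : C) : C :=
  ((Cexp (Ci * z) - Cexp (- (Ci * z))) / (RtoC 2 * Ci))%C.

Definition Ccos (z : C) : C :=
  ((Cexp (Ci * z) + Cexp (- (Ci * z))) / RtoC 2)%C.

(* Rayleigh's formulas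
     j_l(z) = z^l (-(1/z) d/dz)^l (sin z / z),
     y_l(z) = z^l (-(1/z) d/dz)^l (- cos z / z),
   valid for z <> 0.  [C_derive] is total and agrees with the complex
   derivative wherever the latter exists ([is_C_derive_unique]), in particular
   throughout z <> 0; the values at z = 0 are junk, including that of j_l,
   whose removable singularity there is not filled in. *)
Definition rayleigh_op (f : C -> C) : C -> C :=
  fun z => (- (C_derive f z / z))%C.

Definition sph_j (l : nat) (z : C) : C :=
  (z ^ l * Nat.iter l rayleigh_op (fun w => Csin w / w) z)%C.

Definition sph_y (l : nat) (z : C) : C :=
  (z ^ l * Nat.iter l rayleigh_op (fun w => - (Ccos w / w)) z)%C.

Definition sph_h1 (l : nat) (z : C) : C := (sph_j l z + Ci * sph_y l z)%C.

Definition psi (l : nat) (z : C) : C := (z * sph_j l z)%C.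
Definition xi (l : nat) (z : C) : C := (z * sph_h1 l z)%C.

Definition a2 (l : nat) (kb : C) (a : R) : R :=
  let z := (kb * RtoC a)%C in
  - Im (Cconj kb / RtoC (Re kb) * C_derive (xi l) z * Cconj (xi l z))%C.

Definition b2 (l : nat) (kb : C) (a : R) : C :=
  let z := (kb * RtoC a)%C in
  (1 / (RtoC 2 * Ci) *
   (- (Cconj kb / RtoC (Re kb) * C_derive (xi l) z * Cconj (psi l z))
    + kb / RtoC (Re kb) * Cconj (C_derive (psi l) z) * xi l z))%C.

Definition c2 (l : nat) (kb : C) (a : R) : R :=
  let z := (kb * RtoC a)%C in
  - Im (Cconj kb / RtoC (Re kb) * C_derive (psi l) z * Cconj (psi l z))%C.

Definition Cabs2 (l : nat) (kb : C) (a : R) (t : C) : R :=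
  2 * PI * (2 * INR l + 1) / Cmod kb ^ 2 *
  (a2 l kb a * Cmod t ^ 2 + 2 * Re (b2 l kb a * t)%C + c2 l kb a).

(* Concavity on C viewed as a real vector space. *)
Definition strictly_concave (f : C -> R) : Prop :=
  forall (s t : C) (lam : R), s <> t -> 0 < lam < 1 ->
    lam * f s + (1 - lam) * f t < f (RtoC lam * s + RtoC (1 - lam) * t)%C.

Definition is_maximizer (f : C -> R) (t : C) : Prop := forall s, f s <= f t.

Definition is_maximal_value (f : C -> R) (m : R) : Prop :=
  exists t, is_maximizer f t /\ f t = m.

(* Main.v *)
Require Import Defs.
From Stdlib Require Import Reals Lra.
From Coquelicot Require Import Coquelicot.
Open Scope R_scope.

(* With z = k_b a, negativity of a_{2l} amounts to Im (z^* xi_l' xi_l^* ) > 0.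
   Put w_l = z xi_l' / xi_l.  The recurrences
     z xi_l' = (l+1) xi_l - z xi_{l+1},   z xi_{l+1}' = z xi_l - (l+1) xi_{l+1}
   show that, when Im z^2 >= 0, the pair of conditions Im w_l > 0 and
   Im ((z^* )^2 w_l) > 0 passes from l to l + 1: up to nonnegative terms and
   positive factors, the recurrence exchanges the two.  For l = 0 one has
   w_0 = i z, and both conditions say Re z > 0. *)

(** * Complex derivatives *)

(* [is_C_derive_unique] uses the normed module structure [C_NormedModule] on C,
   whereas Coquelicot's product and chain rules use the one of this
   definition. *)
Definition is_Cderive (f : C -> C) (z l : C) : Prop :=
  @is_derive C_AbsRing (AbsRing_NormedModule C_AbsRing) f z l.

(** The remainder clause is the same in both structures up to conversion; only linearity is proved
    again. *)
Lemma is_Cderive_C_derive (f : C -> C) (z l : C) :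
  is_Cderive f z l -> C_derive f z = l.
Proof.
  intros [_ H]; apply is_C_derive_unique; split.
  - apply is_linear_scal_l.
  - exact H.
Qed.

Lemma is_Cderive_eq (f : C -> C) (z l l' : C) :
  is_Cderive f z l -> l = l' -> is_Cderive f z l'.
Proof. now intros H <-. Qed.

(** A remainder of order |h|^2 is o(|h|): for |h| < e / M the bound M |h|^2 is at most e |h|. This
    serves [Cinv] and [Cexp], which are differentiated from the definition. *)
Lemma is_Cderive_quadratic_remainder (f : C -> C) (z l : C) (M d : R) :
  0 < M -> 0 < d ->
  (forall h : C, Cmod h < d ->
     Cmod (f (z + h) - f z - h * l)%C <= M * Cmod h ^ 2) ->
  is_Cderive f z l.
Proof.
  intros HM Hd H; split.
  - apply is_linear_scal_l.
  - intros x Hx; apply (is_filter_lim_locally_unique (K := C_AbsRing)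
      (V := AbsRing_NormedModule C_AbsRing)) in Hx; subst x.
    intros [e He].
    assert (Hd' : 0 < Rmin d (e / M)).
    { apply Rmin_glb_lt; [exact Hd|]. now apply Rdiv_lt_0_compat. }
    exists (mkposreal _ Hd').
    change (forall w : C, Cmod (w - z)%C < Rmin d (e / M) ->
              Cmod (f w - f z - (w - z) * l)%C <= e * Cmod (w - z)%C).
    intros w Hw.
    specialize (H (w - z)%C (Rlt_le_trans _ _ _ Hw (Rmin_l _ _))).
    replace (z + (w - z))%C with w in H by ring.
    pose proof (Cmod_ge_0 (w - z)%C).
    assert (Cmod (w - z)%C * M <= e).
    { apply Rlt_le, (Rmult_lt_reg_r (/ M)); [now apply Rinv_0_lt_compat|].
      rewrite Rmult_assoc, Rinv_r, Rmult_1_r by lra.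
      exact (Rlt_le_trans _ _ _ Hw (Rmin_r _ _)). }
    nra.
Qed.

(** The open disc of radius |z| about z misses 0. The closed forms of the Rayleigh iterates are
    established off 0 only, hence this form of extensionality. *)
Lemma is_Cderive_ext_nonzero (f g : C -> C) (z l : C) :
  z <> 0 -> (forall w : C, w <> 0 -> f w = g w) ->
  is_Cderive f z l -> is_Cderive g z l.
Proof.
  intros Hz E; apply is_derive_ext_loc.
  assert (H : 0 < Cmod z) by now apply Cmod_gt_0.
  exists (mkposreal _ H).
  change (forall w : C, Cmod (w - z)%C < Cmod z -> f w = g w).
  intros w Hw; apply E; intros ->.
  replace (0 - z)%C with (- z)%C in Hw by ring.
  rewrite Cmod_opp in Hw; lra.
Qed.

Lemma is_Cderive_plus (f g : C -> C) (z df dg : C) :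
  is_Cderive f z df -> is_Cderive g z dg ->
  is_Cderive (fun w => f w + g w)%C z (df + dg)%C.
Proof. exact (is_derive_plus (K := C_AbsRing)
         (V := AbsRing_NormedModule C_AbsRing) f g z df dg). Qed.

Lemma is_Cderive_opp (f : C -> C) (z df : C) :
  is_Cderive f z df -> is_Cderive (fun w => - f w)%C z (- df)%C.
Proof. exact (is_derive_opp (K := C_AbsRing)
         (V := AbsRing_NormedModule C_AbsRing) f z df). Qed.

Lemma is_Cderive_mult (f g : C -> C) (z df dg : C) :
  is_Cderive f z df -> is_Cderive g z dg ->
  is_Cderive (fun w => f w * g w)%C z (df * g z + f z * dg)%C.
Proof.
  intros Hf Hg; apply (is_derive_mult (K := C_AbsRing) f g z df dg Hf Hg).
  exact Cmult_comm.
Qed.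

Lemma is_Cderive_comp (f g : C -> C) (z df dg : C) :
  is_Cderive f (g z) df -> is_Cderive g z dg ->
  is_Cderive (fun w => f (g w)) z (dg * df)%C.
Proof. exact (is_derive_comp (K := C_AbsRing)
         (V := AbsRing_NormedModule C_AbsRing) f g z df dg). Qed.

Lemma is_Cderive_const (c z : C) : is_Cderive (fun _ => c) z 0.
Proof. exact (is_derive_const (K := C_AbsRing)
         (V := AbsRing_NormedModule C_AbsRing) c z). Qed.

Lemma is_Cderive_id (z : C) : is_Cderive (fun w => w) z 1.
Proof. exact (is_derive_id (K := C_AbsRing) z). Qed.

Lemma is_Cderive_pow (n : nat) (z : C) :
  is_Cderive (fun w => w ^ S n)%C z (RtoC (INR (S n)) * z ^ n)%C.
Proof.
  induction n as [|n IH].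
  - apply (is_derive_ext (K := C_AbsRing) (V := AbsRing_NormedModule C_AbsRing)
             (fun w : C => w)).
    + intros w; simpl; symmetry; apply Cmult_1_r.
    + eapply is_Cderive_eq; [apply is_Cderive_id|]; simpl; ring.
  - eapply is_Cderive_eq.
    + apply (is_Cderive_mult (fun w => w) (fun w => w ^ S n)%C);
        [apply is_Cderive_id | apply IH].
    + rewrite (S_INR (S n)), RtoC_plus; simpl; ring.
Qed.

(** The remainder is exactly h^2 / ((z + h) z^2), and |h| < |z| / 2 forces |z + h| >= |z| / 2,
    whence the constant 2 / |z|^3. *)
Lemma is_Cderive_inv (z : C) :
  z <> 0 -> is_Cderive Cinv z (- (/ (z * z)))%C.
Proof.
  intros Hz.
  assert (Hm : 0 < Cmod z) by now apply Cmod_gt_0.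
  apply (is_Cderive_quadratic_remainder _ _ _ (2 / Cmod z ^ 3) (Cmod z / 2)).
  - apply Rdiv_lt_0_compat; [lra | now apply pow_lt].
  - lra.
  - intros h Hh.
    assert (Hzh : Cmod z / 2 <= Cmod (z + h)%C).
    { pose proof (Cmod_triangle (z + h)%C (- h)%C) as T.
      rewrite Cmod_opp in T.
      replace (z + h + - h)%C with z in T by ring. lra. }
    assert (Hn : (z + h)%C <> 0) by (apply Cmod_gt_0; lra).
    replace (/ (z + h) - / z - h * - / (z * z))%C
      with (h * h / ((z + h) * (z * z)))%C by (field; auto).
    rewrite Cmod_div by (repeat apply Cmult_neq_0; auto).
    rewrite !Cmod_mult.
    replace (2 / Cmod z ^ 3 * Cmod h ^ 2)
      with (Cmod h * Cmod h / (Cmod z / 2 * (Cmod z * Cmod z)))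
      by (field; lra).
    apply Rmult_le_compat_l; [pose proof (Cmod_ge_0 h); nra|].
    apply Rinv_le_contravar.
    + repeat apply Rmult_lt_0_compat; lra.
    + apply Rmult_le_compat_r; nra.
Qed.

Lemma is_Cderive_div_id (f : C -> C) (z df : C) :
  z <> 0 -> is_Cderive f z df ->
  is_Cderive (fun w => f w / w)%C z ((df - f z / z) / z)%C.
Proof.
  intros Hz Hf; eapply is_Cderive_eq.
  - apply (is_Cderive_mult f Cinv); [exact Hf | now apply is_Cderive_inv].
  - field; exact Hz.
Qed.

(** * Taylor remainders and the derivatives of exp, sin and cos *)

Lemma Cmod_le_Rabs (z : C) : Cmod z <= Rabs (Re z) + Rabs (Im z).
Proof.
  apply Rsqr_incr_0_var.
  - unfold Rsqr; replace (Cmod z * Cmod z) with (Cmod z ^ 2) by ring.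
    rewrite Cmod2_alt.
    rewrite <- (pow2_abs (Re z)), <- (pow2_abs (Im z)).
    pose proof (Rabs_pos (Re z)); pose proof (Rabs_pos (Im z)); nra.
  - pose proof (Rabs_pos (Re z)); pose proof (Rabs_pos (Im z)); lra.
Qed.

(** For the upper bound, exp (-x) >= 1 - x gives exp x (1 - x) <= 1, while (1 + x + 2 x^2)(1 - x) =
    1 + x^2 (1 - 2 x) >= 1 as x <= 1/2. *)
Lemma exp_remainder (x : R) :
  Rabs x <= / 2 -> 0 <= exp x - 1 - x <= 2 * x ^ 2.
Proof.
  intros Hx; apply Rabs_le_between in Hx.
  pose proof (exp_ineq1_le x); pose proof (exp_ineq1_le (- x)) as H'.
  pose proof (exp_pos x).
  assert (E : exp x * exp (- x) = 1)
    by (rewrite <- exp_plus, Rplus_opp_r; apply exp_0).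
  assert (exp x * (1 - x) <= 1) by nra.
  assert (1 <= (1 + x + 2 * x ^ 2) * (1 - x)) by nra.
  split; [lra|].
  assert (exp x <= 1 + x + 2 * x ^ 2); [|lra].
  apply (Rmult_le_reg_r (1 - x)); lra.
Qed.

(** By the mean value theorem 1 - cos y = y sin c with c between 0 and y; a second application gives
    |sin c| <= |c| <= |y|. *)
Lemma cos_remainder (y : R) : 0 <= 1 - cos y <= y ^ 2.
Proof.
  pose proof (COS_bound y); split; [lra|].
  destruct (MVT_gen cos 0 y (fun x => - sin x)) as (c & Hc & E).
  - intros x _; apply is_derive_cos.
  - intros x _; apply continuity_cos.
  - rewrite cos_0 in E.
    assert (Hs : Rabs (sin c) <= Rabs y).
    { apply Rle_trans with (Rabs c).
      - destruct (MVT_gen sin 0 c cos) as (c' & _ & E').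
        + intros x _; apply is_derive_sin.
        + intros x _; apply continuity_sin.
        + rewrite sin_0, !Rminus_0_r in E'; rewrite E', Rabs_mult.
          pose proof (COS_bound c').
          assert (Rabs (cos c') <= 1) by (apply Rabs_le; lra).
          pose proof (Rabs_pos c); nra.
      - destruct (Rle_dec 0 y).
        + rewrite Rmin_left, Rmax_right in Hc by lra.
          rewrite !Rabs_pos_eq; lra.
        + rewrite Rmin_right, Rmax_left in Hc by lra.
          rewrite !Rabs_left1; lra. }
    replace (1 - cos y) with (sin c * y) by lra.
    apply Rle_trans with (Rabs (sin c * y)); [apply Rle_abs|].
    rewrite Rabs_mult, <- (pow2_abs y); pose proof (Rabs_pos y); nra.
Qed.

(** The mean value theorem for sin x - x gives the bound |y|^3, which |y| <= 1 weakens to y^2. *)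
Lemma sin_remainder (y : R) : Rabs y <= 1 -> Rabs (sin y - y) <= y ^ 2.
Proof.
  intros Hy.
  destruct (MVT_gen (fun x => sin x - x) 0 y (fun x => cos x - 1))
    as (c & Hc & E).
  - intros x _; apply (is_derive_minus sin (fun x => x) x (cos x) 1).
    + apply is_derive_sin.
    + apply (is_derive_id (K := R_AbsRing)).
  - intros x _; apply continuity_pt_minus.
    + apply continuity_sin.
    + apply continuity_pt_id.
  - rewrite sin_0, !Rminus_0_r in E; rewrite E, Rabs_mult.
    pose proof (cos_remainder c).
    assert (c ^ 2 <= y ^ 2).
    { destruct (Rle_dec 0 y).
      - rewrite Rmin_left, Rmax_right in Hc by lra; nra.
      - rewrite Rmin_right, Rmax_left in Hc by lra; nra. }
    rewrite Rabs_left1 by lra.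
    rewrite <- (pow2_abs y) in *; pose proof (Rabs_pos y); nra.
Qed.

Lemma Cexp_plus (z w : C) : Cexp (z + w) = (Cexp z * Cexp w)%C.
Proof.
  unfold Cexp, Cmult, Re, Im; simpl.
  rewrite exp_plus, cos_plus, sin_plus; f_equal; ring.
Qed.

Lemma Cexp_neq_0 (z : C) : Cexp z <> 0.
Proof.
  intros E; injection E as E1 E2.
  pose proof (exp_pos (Re z)); pose proof (sin2_cos2 (Im z)) as H1.
  unfold Rsqr in H1.
  apply Rmult_integral in E1; apply Rmult_integral in E2.
  destruct E1 as [|E1], E2 as [|E2]; try lra.
  rewrite E1, E2 in H1; lra.
Qed.

(** Real and imaginary parts are bounded separately, the real part being (exp x - 1 - x) - exp x (1
    - cos y). The two bounds add up to 5 (x^2 + y^2), so 8 leaves room. *)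
Lemma Cexp_remainder (h : C) :
  Cmod h <= / 2 -> Cmod (Cexp h - 1 - h)%C <= 8 * Cmod h ^ 2.
Proof.
  intros Hh; pose proof (Rmax_Cmod h) as Hm.
  destruct h as [x y]; rewrite Cmod2_alt; simpl fst in Hm; simpl snd in Hm.
  assert (Hx : Rabs x <= / 2)
    by (eapply Rle_trans; [apply Rmax_l|]; eapply Rle_trans; eauto).
  assert (Hy : Rabs y <= / 2)
    by (eapply Rle_trans; [apply Rmax_r|]; eapply Rle_trans; eauto).
  clear Hm Hh.
  pose proof (exp_remainder x Hx) as He.
  pose proof (cos_remainder y) as Hc.
  assert (Hs : Rabs (sin y - y) <= y ^ 2) by (apply sin_remainder; lra).
  apply Rabs_le_between in Hx; apply Rabs_le_between in Hs;
    apply Rabs_le_between in Hy.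
  eapply Rle_trans; [apply Cmod_le_Rabs|].
  unfold Cexp; simpl Re; simpl Im; cbn [fst snd].
  assert (HeB : 0 <= exp x <= 2).
  { pose proof (exp_pos x); assert (x ^ 2 <= / 4) by nra; lra. }
  assert (Rabs (exp x * cos y + - (1) + - x) <= 2 * x ^ 2 + 2 * y ^ 2).
  { apply Rabs_le.
    assert (0 <= exp x * (1 - cos y) <= 2 * y ^ 2) by nra.
    nra. }
  assert (Rabs (exp x * sin y + - 0 + - y) <= 3 * x ^ 2 + 3 * y ^ 2).
  { apply Rabs_le.
    assert (- (2 * y ^ 2) <= exp x * (sin y - y) <= 2 * y ^ 2) by nra.
    assert (- x ^ 2 <= (exp x - 1 - x) * y <= x ^ 2).
    (* Since |y| <= 1/2 and 0 <= r <= 2 x^2, the product r y lies within r / 2 <= x^2 of 0. *)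
    { set (r := exp x - 1 - x) in *.
      assert (0 <= r * (y + / 2)) by (apply Rmult_le_pos; lra).
      assert (0 <= r * (/ 2 - y)) by (apply Rmult_le_pos; lra).
      lra. }
    pose proof (pow2_ge_0 (x + y)); pose proof (pow2_ge_0 (x - y)).
    assert (- (x ^ 2 + y ^ 2) <= 2 * (x * y) <= x ^ 2 + y ^ 2) by lra.
    pose proof (pow2_ge_0 x); pose proof (pow2_ge_0 y).
    replace (exp x * sin y + - 0 + - y)
      with (exp x * (sin y - y) + (exp x - 1 - x) * y + x * y) by ring.
    lra. }
  pose proof (pow2_ge_0 x); pose proof (pow2_ge_0 y); lra.
Qed.

(** The functional equation carries the expansion at 0 to z, with the constant scaled by |exp z|. *)
Lemma is_Cderive_exp (z : C) : is_Cderive Cexp z (Cexp z).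
Proof.
  assert (H0 : 0 < Cmod (Cexp z)) by (apply Cmod_gt_0, Cexp_neq_0).
  apply (is_Cderive_quadratic_remainder _ _ _ (Cmod (Cexp z) * 8) (/ 2)).
  - lra.
  - lra.
  - intros h Hh; rewrite Cexp_plus.
    replace (Cexp z * Cexp h - Cexp z - h * Cexp z)%C
      with (Cexp z * (Cexp h - 1 - h))%C by ring.
    rewrite Cmod_mult, Rmult_assoc.
    apply Rmult_le_compat_l; [lra|].
    apply Cexp_remainder; lra.
Qed.

Lemma is_Cderive_exp_Ci (z : C) :
  is_Cderive (fun w => Cexp (Ci * w))%C z (Ci * Cexp (Ci * z))%C.
Proof.
  apply (is_Cderive_comp Cexp (fun w => Ci * w)%C); [apply is_Cderive_exp|].
  eapply is_Cderive_eq.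
  - apply (is_Cderive_mult (fun _ => Ci) (fun w => w));
      [apply is_Cderive_const | apply is_Cderive_id].
  - ring.
Qed.

Lemma is_Cderive_exp_opp_Ci (z : C) :
  is_Cderive (fun w => Cexp (- (Ci * w)))%C z (- (Ci * Cexp (- (Ci * z))))%C.
Proof.
  eapply is_Cderive_eq.
  - apply (is_Cderive_comp Cexp (fun w => - (Ci * w))%C);
      [apply is_Cderive_exp|].
    apply (is_Cderive_opp (fun w => Ci * w)%C).
    apply (is_Cderive_mult (fun _ => Ci) (fun w => w));
      [apply is_Cderive_const | apply is_Cderive_id].
  - ring.
Qed.

Lemma Ci_neq_0 : Ci <> 0.
Proof. intros E; injection E; lra. Qed.

Lemma Ci_sqr : (Ci * Ci)%C = (- (1))%C.
Proof. unfold Ci, Cmult, Copp, RtoC; simpl; f_equal; ring. Qed.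

Lemma is_Cderive_sin (z : C) : is_Cderive Csin z (Ccos z).
Proof.
  eapply is_Cderive_eq.
  - apply (is_Cderive_mult (fun w => Cexp (Ci * w) - Cexp (- (Ci * w)))%C
             (fun _ => / (RtoC 2 * Ci))%C).
    + apply is_Cderive_plus; [apply is_Cderive_exp_Ci|].
      apply (is_Cderive_opp (fun w => Cexp (- (Ci * w)))).
      apply is_Cderive_exp_opp_Ci.
    + apply is_Cderive_const.
  - unfold Ccos; field; apply Ci_neq_0.
Qed.

Lemma is_Cderive_cos (z : C) : is_Cderive Ccos z (- Csin z)%C.
Proof.
  eapply is_Cderive_eq.
  - apply (is_Cderive_mult (fun w => Cexp (Ci * w) + Cexp (- (Ci * w)))%C
             (fun _ => / RtoC 2)%C).
    + apply (is_Cderive_plus (fun w => Cexp (Ci * w))%C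
               (fun w => Cexp (- (Ci * w)))%C);
        [apply is_Cderive_exp_Ci | apply is_Cderive_exp_opp_Ci].
    + apply is_Cderive_const.
  - unfold Csin.
    set (u := Cexp (Ci * z)); set (v := Cexp (- (Ci * z))).
    (* [field] treats [Ci] as an atom, so i^2 = -1 is supplied by hand. *)
    assert (E : (/ Ci)%C = (- Ci)%C).
    { transitivity (- (Ci * Ci) * / Ci)%C; [rewrite Ci_sqr; ring|].
      field; apply Ci_neq_0. }
    replace (- ((u - v) / (RtoC 2 * Ci)))%C
      with (- ((u - v) / RtoC 2 * / Ci))%C
      by (field; apply Ci_neq_0).
    rewrite E; field.
Qed.

(** * Rayleigh's formulas and the Riccati-Hankel recurrences *)

(** [f1] is a closed form of [rayleigh_op f], and the two hypotheses together say that f solves the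
    spherical Bessel equation of order 0. As [C_derive] is total, existence of the derivatives has
    to be carried through the induction along with their values. *)
Lemma rayleigh_iter_derive (f f1 : C -> C) :
  (forall z : C, z <> 0 -> is_Cderive f z (- (z * f1 z))%C) ->
  (forall z : C, z <> 0 -> is_Cderive f1 z ((f z - 3 * f1 z) / z)%C) ->
  forall (l : nat) (z : C), z <> 0 ->
    is_Cderive (Nat.iter l rayleigh_op f) z
      (- (z * Nat.iter (S l) rayleigh_op f z))%C /\
    is_Cderive (Nat.iter (S l) rayleigh_op f) z
      ((Nat.iter l rayleigh_op f z
        - RtoC (2 * INR l + 3) * Nat.iter (S l) rayleigh_op f z) / z)%C.
Proof.
  intros Hf Hf1 l; induction l as [|l IH]; intros z Hz.
  - assert (E : forall w : C, w <> 0 -> f1 w = rayleigh_op f w).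
    { intros w Hw; unfold rayleigh_op.
      rewrite (is_Cderive_C_derive _ _ _ (Hf w Hw)); field; exact Hw. }
    simpl; rewrite <- E by exact Hz.
    replace (2 * 0 + 3) with 3 by ring.
    split; [now apply Hf|].
    apply (is_Cderive_ext_nonzero f1); auto.
  - set (g := Nat.iter l rayleigh_op f) in *.
    set (g1 := Nat.iter (S l) rayleigh_op f) in *.
    set (c := RtoC (2 * INR l + 3)) in *.
    change (Nat.iter (S (S l)) rayleigh_op f) with (rayleigh_op g1).
    (* Off 0 the next iterate is a rational expression in the two previous ones (the three-term
       recurrence), hence differentiable. *)
    assert (E : forall w : C, w <> 0 ->
              (- ((g w - c * g1 w) / w / w))%C = rayleigh_op g1 w).
    { intros w Hw; unfold rayleigh_op.
      now rewrite (is_Cderive_C_derive _ _ _ (proj2 (IH w Hw))). }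
    assert (H1 : is_Cderive g1 z (- (z * rayleigh_op g1 z))%C).
    { eapply is_Cderive_eq; [apply (IH z Hz)|].
      rewrite <- E by exact Hz; field; exact Hz. }
    split; [exact H1|].
    apply (is_Cderive_ext_nonzero _ _ _ _ Hz E).
    eapply is_Cderive_eq.
    + apply (is_Cderive_opp (fun w => (g w - c * g1 w) / w / w)%C).
      apply (is_Cderive_div_id (fun w => (g w - c * g1 w) / w)%C); [exact Hz|].
      apply (is_Cderive_div_id (fun w => g w - c * g1 w)%C); [exact Hz|].
      apply (is_Cderive_plus g (fun w => - (c * g1 w))%C);
        [exact (proj1 (IH z Hz))|].
      apply (is_Cderive_opp (fun w => c * g1 w)%C).
      apply is_Cderive_mult; [apply is_Cderive_const | exact H1].
    + fold g1.
      (* The increment 2 comes from differentiating the factor 1 / w^2. *)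
      replace (RtoC (2 * INR (S l) + 3)) with (c + 2)%C
        by (unfold c; rewrite S_INR, <- RtoC_plus; f_equal; ring).
      rewrite <- E by exact Hz; field; exact Hz.
Qed.

Lemma rayleigh_sin_derive (l : nat) (z : C) :
  z <> 0 ->
  let g := fun n => Nat.iter n rayleigh_op (fun w => Csin w / w)%C in
  is_Cderive (g l) z (- (z * g (S l) z))%C /\
  is_Cderive (g (S l)) z
    ((g l z - RtoC (2 * INR l + 3) * g (S l) z) / z)%C.
Proof.
  intros Hz.
  (* The supplied closed form is j_1(z) / z. *)
  apply (rayleigh_iter_derive _ (fun w => (Csin w / w - Ccos w) / w / w)%C);
    [clear z Hz; intros z Hz .. | exact Hz].
  - eapply is_Cderive_eq.
    + apply is_Cderive_div_id; [exact Hz | apply is_Cderive_sin].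
    + field; exact Hz.
  - eapply is_Cderive_eq.
    + apply (is_Cderive_div_id (fun w => (Csin w / w - Ccos w) / w)%C);
        [exact Hz|].
      apply (is_Cderive_div_id (fun w => Csin w / w - Ccos w)%C); [exact Hz|].
      apply is_Cderive_plus.
      * apply is_Cderive_div_id; [exact Hz | apply is_Cderive_sin].
      * apply is_Cderive_opp, is_Cderive_cos.
    + field; exact Hz.
Qed.

Lemma rayleigh_cos_derive (l : nat) (z : C) :
  z <> 0 ->
  let g := fun n => Nat.iter n rayleigh_op (fun w => - (Ccos w / w))%C in
  is_Cderive (g l) z (- (z * g (S l) z))%C /\
  is_Cderive (g (S l)) z
    ((g l z - RtoC (2 * INR l + 3) * g (S l) z) / z)%C.
Proof.
  intros Hz.
  (* Here the closed form is y_1(z) / z. *)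
  apply (rayleigh_iter_derive _ (fun w => - ((Ccos w / w + Csin w) / w / w))%C);
    [clear z Hz; intros z Hz .. | exact Hz].
  - eapply is_Cderive_eq.
    + apply (is_Cderive_opp (fun w => Ccos w / w)%C).
      apply is_Cderive_div_id; [exact Hz | apply is_Cderive_cos].
    + field; exact Hz.
  - eapply is_Cderive_eq.
    + apply (is_Cderive_opp (fun w => (Ccos w / w + Csin w) / w / w)%C).
      apply (is_Cderive_div_id (fun w => (Ccos w / w + Csin w) / w)%C);
        [exact Hz|].
      apply (is_Cderive_div_id (fun w => Ccos w / w + Csin w)%C); [exact Hz|].
      apply is_Cderive_plus.
      * apply is_Cderive_div_id; [exact Hz | apply is_Cderive_cos].
      * apply is_Cderive_sin.
    + field; exact Hz.
Qed.

(** With xi_n = z^(n+1) (s_n + i c_n), the product rule turns the derivative formulas of the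
    Rayleigh iterates into the recurrences. *)
Lemma xi_derive (l : nat) (z : C) :
  z <> 0 ->
  is_Cderive (xi l) z (RtoC (INR (S l)) * xi l z / z - xi (S l) z)%C /\
  is_Cderive (xi (S l)) z (xi l z - RtoC (INR (S l)) * xi (S l) z / z)%C.
Proof.
  intros Hz.
  set (s := fun n => Nat.iter n rayleigh_op (fun w => Csin w / w)%C).
  set (c := fun n => Nat.iter n rayleigh_op (fun w => - (Ccos w / w))%C).
  set (h := fun n w => (s n w + Ci * c n w)%C).
  assert (E : forall n w, (w ^ S n * h n w)%C = xi n w).
  { intros n w; unfold xi, sph_h1, sph_j, sph_y, h, s, c; simpl; ring. }
  destruct (rayleigh_sin_derive l z Hz) as [Hs Hs1].
  destruct (rayleigh_cos_derive l z Hz) as [Hc Hc1].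
  fold (s l) (s (S l)) in Hs, Hs1; fold (c l) (c (S l)) in Hc, Hc1.
  split.
  - apply (is_derive_ext (K := C_AbsRing) (V := AbsRing_NormedModule C_AbsRing)
             (fun w => w ^ S l * h l w)%C);
      [apply E|].
    eapply is_Cderive_eq.
    + apply (is_Cderive_mult (fun w => w ^ S l)%C (h l));
        [apply is_Cderive_pow|].
      apply is_Cderive_plus; [exact Hs|].
      apply is_Cderive_mult; [apply is_Cderive_const | exact Hc].
    + rewrite <- !E; unfold h; cbn [Cpow]; field; exact Hz.
  - apply (is_derive_ext (K := C_AbsRing) (V := AbsRing_NormedModule C_AbsRing)
            
             (fun w => w ^ S (S l) * h (S l) w)%C); [apply E|].
    eapply is_Cderive_eq.
    + apply (is_Cderive_mult (fun w => w ^ S (S l))%C (h (S l)));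
        [apply is_Cderive_pow|].
      apply is_Cderive_plus; [exact Hs1|].
      apply is_Cderive_mult; [apply is_Cderive_const | exact Hc1].
    + rewrite <- !E; unfold h.
      (* The split 2l + 3 = (l + 1) + (l + 2) lets the second summand cancel against the derivative
         of z^(l+2). *)
      replace (RtoC (2 * INR l + 3))
        with (RtoC (INR (S l)) + RtoC (INR (S (S l))))%C
        by (rewrite <- RtoC_plus, !S_INR; f_equal; ring).
      rewrite S_INR, RtoC_plus; cbn [Cpow].
      field; exact Hz.
Qed.

(** Euler's formula: xi_0 = sin z - i cos z = -i exp(i z). *)
Lemma xi_0 (z : C) : z <> 0 -> xi 0 z = (- (Ci * Cexp (Ci * z)))%C.
Proof.
  intros Hz; unfold xi, sph_h1, sph_j, sph_y, Csin, Ccos; simpl.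
  set (u := Cexp (Ci * z)); set (v := Cexp (- (Ci * z))).
  transitivity ((u - v) / (RtoC 2 * Ci) - Ci * ((u + v) / RtoC 2))%C.
  - field; split; [apply Ci_neq_0 | exact Hz].
  - transitivity (((u - v) - (Ci * Ci) * (u + v)) / (RtoC 2 * Ci))%C;
      [field; apply Ci_neq_0|].
    transitivity (- ((Ci * Ci) * u / Ci))%C;
      [rewrite Ci_sqr |]; field; apply Ci_neq_0.
Qed.

Lemma xi_0_derive (z : C) : z <> 0 -> C_derive (xi 0) z = (Ci * xi 0 z)%C.
Proof.
  intros Hz; apply is_Cderive_C_derive.
  apply (is_Cderive_ext_nonzero (fun w => - (Ci * Cexp (Ci * w)))%C);
    [exact Hz | intros w Hw; symmetry; now apply xi_0 |].
  eapply is_Cderive_eq.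
  - apply (is_Cderive_opp (fun w => Ci * Cexp (Ci * w))%C).
    apply is_Cderive_mult; [apply is_Cderive_const | apply is_Cderive_exp_Ci].
  - rewrite xi_0 by exact Hz; ring.
Qed.

(** * Sign of the quadratic coefficient *)

(* One step of the induction, with [u = xi_l z], [v = xi_{l+1} z], [n = l + 1];
   the first factors are [z xi_l'] and [z xi_{l+1}']. *)
Lemma riccati_step (z u v : C) (n : R) :
  0 <= n -> 0 <= Im (z * z)%C -> z <> 0 ->
  0 < Im ((RtoC n * u - z * v) * Cconj u)%C ->
  0 < Im (Cconj (z * z) * ((RtoC n * u - z * v) * Cconj u))%C ->
  0 < Im ((z * u - RtoC n * v) * Cconj v)%C /\
  0 < Im (Cconj (z * z) * ((z * u - RtoC n * v) * Cconj v))%C.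
Proof.
  intros Hn Hzz Hz HP HQ.
  assert (Hm : 0 < Cmod z ^ 2) by (apply pow_lt; now apply Cmod_gt_0).
  (* On the right the |u|^2 terms cancel, and z conj(z)^2 = |z|^2 conj(z) reduces the rest to a
     conjugate of z u conj(v). [E1] draws on the second hypothesis and [E2] on the first: this is
     the exchange of the two conditions. *)
  assert (E1 : Cmod z ^ 2 * Im ((z * u - RtoC n * v) * Cconj v)%C
     = n * Cmod u ^ 2 * Im (z * z)%C
       + Im (Cconj (z * z) * ((RtoC n * u - z * v) * Cconj u))%C).
  { rewrite !Cmod2_alt; destruct z, u, v; simpl; ring. }
  assert (E2 : Im (Cconj (z * z) * ((z * u - RtoC n * v) * Cconj v))%C
     = Cmod z ^ 2 * Im ((RtoC n * u - z * v) * Cconj u)%C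
       + n * Cmod v ^ 2 * Im (z * z)%C).
  { rewrite !Cmod2_alt; destruct z, u, v; simpl; ring. }
  pose proof (pow2_ge_0 (Cmod u)); pose proof (pow2_ge_0 (Cmod v)).
  assert (0 <= n * Cmod u ^ 2 * Im (z * z)%C)
    by (apply Rmult_le_pos; [now apply Rmult_le_pos | exact Hzz]).
  assert (0 <= n * Cmod v ^ 2 * Im (z * z)%C)
    by (apply Rmult_le_pos; [now apply Rmult_le_pos | exact Hzz]).
  split.
  - apply (Rmult_lt_reg_l (Cmod z ^ 2)); [exact Hm | lra].
  - rewrite E2; nra.
Qed.

(** These are the two conditions on w_l multiplied by |xi_l|^2, so that no division by xi_l occurs.
    The quadrant assumption on z gives Im z^2 >= 0. *)
Lemma xi_log_derive_pos (l : nat) (z : C) :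
  0 < Re z -> 0 <= Im z ->
  0 < Im (z * C_derive (xi l) z * Cconj (xi l z))%C /\
  0 < Im (Cconj (z * z) * (z * C_derive (xi l) z * Cconj (xi l z)))%C.
Proof.
  intros Hre Him.
  assert (Hz : z <> 0) by (intros ->; simpl in Hre; lra).
  assert (Hm : 0 < Cmod z ^ 2) by (apply pow_lt; now apply Cmod_gt_0).
  assert (Hzz : 0 <= Im (z * z)%C).
  { destruct z as [x y]; simpl in *; nra. }
  induction l as [|l [IHP IHQ]].
  - rewrite xi_0_derive by exact Hz.
    assert (Hx : 0 < Cmod (xi 0 z) ^ 2).
    { rewrite xi_0, Cmod_opp by exact Hz.
      apply pow_lt, Cmod_gt_0, Cmult_neq_0;
        [apply Ci_neq_0 | apply Cexp_neq_0]. }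
    replace (Im (z * (Ci * xi 0 z) * Cconj (xi 0 z))%C)
      with (Re z * Cmod (xi 0 z) ^ 2)
      by (rewrite Cmod2_alt; destruct z, (xi 0 _); simpl; ring).
    replace (Im (Cconj (z * z) * (z * (Ci * xi 0 z) * Cconj (xi 0 z)))%C)
      with (Cmod z ^ 2 * (Re z * Cmod (xi 0 z) ^ 2))
      by (rewrite !Cmod2_alt; destruct z, (xi 0 _); simpl; ring).
    auto using Rmult_lt_0_compat.
  - destruct (xi_derive l z Hz) as [D1 D2].
    apply is_Cderive_C_derive in D1, D2.
    rewrite D1 in IHP, IHQ; rewrite D2.
    replace (z * (xi l z - RtoC (INR (S l)) * xi (S l) z / z))%C
      with (z * xi l z - RtoC (INR (S l)) * xi (S l) z)%C
      by (field; exact Hz).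
    replace (z * (RtoC (INR (S l)) * xi l z / z - xi (S l) z))%C
      with (RtoC (INR (S l)) * xi l z - z * xi (S l) z)%C in IHP, IHQ
      by (field; exact Hz).
    apply riccati_step; auto using pos_INR.
Qed.

Lemma a2_neg (l : nat) (kb : C) (a : R) :
  0 < a -> 0 < Re kb -> 0 <= Im kb -> a2 l kb a < 0.
Proof.
  intros Ha Hre Him; unfold a2; cbv zeta.
  set (z := (kb * RtoC a)%C).
  assert (Hzre : 0 < Re z).
  { unfold z; destruct kb as [x y]; simpl in *; nra. }
  assert (Hzim : 0 <= Im z).
  { unfold z; destruct kb as [x y]; simpl in *; nra. }
  destruct (xi_log_derive_pos l z Hzre Hzim) as [_ HQ].
  set (p := C_derive (xi l) z) in *; set (q := xi l z) in *.
  assert (Hkb : 0 < Cmod kb ^ 2) by (rewrite Cmod2_alt; nra).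
  (* For z = a k_b one has conj(z)^2 z = a^3 |k_b|^2 conj(k_b); the factor Re k_b compensates the
     division in [a2]. *)
  assert (E : Im (Cconj (z * z) * (z * p * Cconj q))%C
    = a ^ 3 * Cmod kb ^ 2 * Re kb
      * Im (Cconj kb / RtoC (Re kb) * p * Cconj q)%C).
  { replace (Cconj kb / RtoC (Re kb) * p * Cconj q)%C
      with (RtoC (/ Re kb) * (Cconj kb * p * Cconj q))%C
      by (rewrite RtoC_inv by lra; unfold Cdiv; ring).
    rewrite Cmod2_alt; unfold z.
    destruct kb, p, q; simpl in *; field; lra. }
  rewrite E in HQ.
  assert (0 < a ^ 3 * Cmod kb ^ 2 * Re kb)
    by auto using Rmult_lt_0_compat, pow_lt.
  assert (0 < Im (Cconj kb / RtoC (Re kb) * p * Cconj q)%C); [|lra].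
  apply (Rmult_lt_reg_l (a ^ 3 * Cmod kb ^ 2 * Re kb)); lra.
Qed.

(** * The quadrant of the principal square root *)

(** Off the cut |z| + Re z > 0: where Re z <= 0, the imaginary part is nonzero and makes |z| exceed
    -Re z. *)
Lemma Re_Csqrt_pos (z : C) : ~ (Im z = 0 /\ Re z <= 0) -> 0 < Re (Csqrt z).
Proof.
  intros H; simpl; apply sqrt_lt_R0.
  assert (0 < Cmod z + Re z); [|lra].
  pose proof (Cmod2_alt z) as E; pose proof (Cmod_ge_0 z) as H0.
  destruct (Rlt_le_dec 0 (Re z)) as [|Hr]; [lra|].
  assert (Im z <> 0) by (intros Hi; apply H; auto).
  assert (0 < Im z ^ 2) by now apply pow2_gt_0.
  nra.
Qed.

Lemma Im_Csqrt_nonneg (z : C) : 0 <= Im z -> 0 <= Im (Csqrt z).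
Proof.
  intros H; simpl; destruct (Rle_dec 0 (Im z)); [|contradiction].
  rewrite Rmult_1_l; apply sqrt_pos.
Qed.

(** * Concave quadratic forms on C *)

(** The shape of [Cabs2] with free coefficients; the instance at hand is convertible to [Cabs2]. *)
Definition quadratic_form (K A : R) (b : C) (c : R) (t : C) : R :=
  K * (A * Cmod t ^ 2 + 2 * Re (b * t)%C + c).

(** The affine terms drop out, and the concavity gap is exactly -K A lam (1 - lam) |s - t|^2. *)
Lemma quadratic_form_strictly_concave (K A : R) (b : C) (c : R) :
  0 < K -> A < 0 -> strictly_concave (quadratic_form K A b c).
Proof.
  intros HK HA s t lam Hst Hlam.
  assert (Hd : 0 < Cmod (s - t)%C ^ 2).
  { apply pow_lt, Cmod_gt_0; intros E; apply Hst.
    replace s with (s - t + t)%C by ring; rewrite E; ring. }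
  assert (E : quadratic_form K A b c (RtoC lam * s + RtoC (1 - lam) * t)%C
    = lam * quadratic_form K A b c s + (1 - lam) * quadratic_form K A b c t
      + K * (- A) * (lam * (1 - lam)) * Cmod (s - t)%C ^ 2).
  { unfold quadratic_form; rewrite !Cmod2_alt.
    destruct s, t, b; simpl; ring. }
  rewrite E.
  assert (0 < K * - A) by (apply Rmult_lt_0_compat; lra).
  assert (0 < lam * (1 - lam)) by nra.
  assert (0 < K * (- A) * (lam * (1 - lam)) * Cmod (s - t)%C ^ 2)
    by (apply Rmult_lt_0_compat; [nra | exact Hd]).
  lra.
Qed.

(** The cross term of |s + conj(b) / A|^2 is 2 Re(b s) / A, because conjugating conj(b) restores
    b. *)
Lemma quadratic_form_complete_square (K A : R) (b : C) (c : R) (s : C) :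
  A <> 0 ->
  quadratic_form K A b c s
  = K * (c - Cmod b ^ 2 / A) + K * A * Cmod (s + Cconj b / RtoC A)%C ^ 2.
Proof.
  intros HA.
  replace (Cconj b / RtoC A)%C with (Cconj b * RtoC (/ A))%C
    by (rewrite RtoC_inv by exact HA; reflexivity).
  unfold quadratic_form; rewrite !Cmod2_alt.
  destruct s, b; simpl; field; exact HA.
Qed.

Lemma quadratic_form_vertex (K A : R) (b : C) (c : R) :
  A <> 0 ->
  quadratic_form K A b c (- (Cconj b / RtoC A))%C = K * (c - Cmod b ^ 2 / A).
Proof.
  intros HA; rewrite quadratic_form_complete_square by exact HA.
  rewrite Cplus_comm, Cplus_opp_r, Cmod_0; ring.
Qed.

Lemma quadratic_form_unique_maximizer (K A : R) (b : C) (c : R) :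
  0 < K -> A < 0 ->
  unique (is_maximizer (quadratic_form K A b c)) (- (Cconj b / RtoC A))%C.
Proof.
  intros HK HA.
  assert (HKA : 0 < K * - A) by (apply Rmult_lt_0_compat; lra).
  split.
  - intros s; rewrite quadratic_form_vertex by lra.
    rewrite quadratic_form_complete_square by lra.
    pose proof (pow2_ge_0 (Cmod (s + Cconj b / RtoC A)%C)).
    nra.
  - intros s Hs; specialize (Hs (- (Cconj b / RtoC A))%C).
    rewrite quadratic_form_vertex in Hs by lra.
    rewrite quadratic_form_complete_square in Hs by lra.
    (* Away from the vertex the square term is strictly negative, which contradicts the maximality
       of s. *)
    destruct (Ceq_dec (s + Cconj b / RtoC A)%C 0) as [E|E].
    + replace s with (s + Cconj b / RtoC A - Cconj b / RtoC A)%C by ring.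
      rewrite E; ring.
    + apply Cmod_gt_0 in E; apply (pow_lt _ 2) in E.
      nra.
Qed.

(** * Optimal absorption cross section of the sphere *)

Theorem mainTheorem1 (l : nat) (a k0 : R) (epsb : C)
    (hl : (1 <= l)%nat) (ha : 0 < a) (hk0 : 0 < k0)
    (hcut : ~ (Im epsb = 0 /\ Re epsb <= 0)) (hpassive : 0 <= Im epsb) :
  let kb : C := (RtoC k0 * Csqrt epsb)%C in
  a2 l kb a < 0 /\
  strictly_concave (Cabs2 l kb a) /\
  unique (is_maximizer (Cabs2 l kb a))
    (- (Cconj (b2 l kb a) / RtoC (a2 l kb a)))%C /\
  is_maximal_value (Cabs2 l kb a)
    (PI * (2 * INR l + 1) / (2 * Cmod kb ^ 2) *
     (- (4 * Cmod (b2 l kb a) ^ 2 / a2 l kb a) + 4 * c2 l kb a)).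
Proof.
  intros kb.
  assert (Hre : 0 < Re kb).
  { pose proof (Re_Csqrt_pos epsb hcut) as H; unfold kb.
    destruct (Csqrt epsb) as [x y]; simpl in *; nra. }
  assert (Him : 0 <= Im kb).
  { pose proof (Im_Csqrt_nonneg epsb hpassive) as H; unfold kb.
    destruct (Csqrt epsb) as [x y]; simpl in *; nra. }
  (* From here on k_b enters only through Re k_b > 0 and Im k_b >= 0. *)
  clearbody kb.
  pose proof (a2_neg l kb a ha Hre Him) as HA.
  assert (Hkb : 0 < Cmod kb ^ 2) by (rewrite Cmod2_alt; nra).
  set (K := 2 * PI * (2 * INR l + 1) / Cmod kb ^ 2).
  assert (HK : 0 < K).
  { pose proof (pos_INR l); pose proof PI_RGT_0.
    apply Rdiv_lt_0_compat; [nra | exact Hkb]. }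
  change (Cabs2 l kb a)
    with (quadratic_form K (a2 l kb a) (b2 l kb a) (c2 l kb a)).
  pose proof (quadratic_form_unique_maximizer K (a2 l kb a) (b2 l kb a)
                (c2 l kb a) HK HA) as Hmax.
  split; [exact HA|].
  split; [now apply quadratic_form_strictly_concave|].
  split; [exact Hmax|].
  eexists; split; [apply Hmax|].
  rewrite quadratic_form_vertex by lra.
  assert (Cmod kb <> 0) by (intros E; rewrite E in Hkb; lra).
  (* The vertex value K (c - |b|^2 / A) takes the stated form once a factor 4 moves from the
     prefactor into the bracket. *)
  unfold K; field; split; [lra | assumption].
Qed.
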